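(* For $n\ge3$, the global quantum discord $D_{A_1:A_2:\cdots:A_n}$ is not completely monogamous.
   Context: All Hilbert spaces are finite-dimensional; states are density operators; $S(\rho)=-\mathrm{Tr}\,\rho\log\rho$ (fixed base); $\rho^X$ is the reduced state on $X$. Partitions. A partition $X_1|\cdots|X_k$ ($k\ge2$) of $A_1\cdots A_n$, or of a subsystem (subset of the parties), consists of nonempty blocks of parties that respect the order: every party in $X_s$ has smaller index than every party in $X_t$ when $s<t$. A block is treated as one particle. Global quantum discord (GQD). For a partition $X_1|\cdots|X_k$ and a state $\rho$ of $X_1\cdots X_k$, let $I(\rho)=\sum_{i=1}^kS(\rho^{X_i})-S(\rho)$ and $$D_{X_1:\cdots:X_k}(\rho)=\min_\Phi\,[I(\rho)-I(\Phi(\rho))],$$ the minimum being over local von Neumann measurements $\Phi(\rho)=\sum_{j_1,\dots,j_k}\Pi_{j_1\cdots j_k}\,\rho\,\Pi_{j_1\cdots j_k}$, $\Pi_{j_1\cdots j_k}=\Pi^{X_1}_{j_1}\otimes\cdots\otimes\Pi^{X_k}_{j_k}$, where each $\{\Pi^{X_i}_{j}\}_j$ is a complete rank-one orthogonal projective measurement on $X_i$. Coarsening. $X_1|\cdots|X_k\succ Y_1|\cdots|Y_l$ (''$Y$ is coarser than $X$'') if $Y$ is obtained from $X$ by some or all of: (C1) discarding some of the blocks; (C2) combining some (order-consecutive) blocks into one; (C3) discarding some of the parties of the last block $X_k$ when it has at least two parties. $\succ^{a,b}$ means that only (C1) and/or (C2) are used. Complete. $D_{A_1:\cdots:A_n}$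 is complete if for all finite-dimensional systems and all states $\rho$ of $A_1\cdots A_n$, $D_{X_1:\cdots:X_k}\ge D_{Y_1:\cdots:Y_l}$ (evaluated on the corresponding reduced states of $\rho$) whenever $X_1|\cdots|X_k\succ^{a,b}Y_1|\cdots|Y_l$ (partitions of $A_1\cdots A_n$ or of a subsystem). The set $\Xi$. If $X_1|\cdots|X_k\succ Y_1|\cdots|Y_l$, then $\Xi(X_1|\cdots|X_k-Y_1|\cdots|Y_l)$ is the set of all partitions $\Gamma$ coarser than $X_1|\cdots|X_k$ that either exclude every subsystem of $Y_1|\cdots|Y_l$ or include some but not all subsystems of $Y_1|\cdots|Y_l$ (i.e. not all subsystems $Y_i$ are included in $\Gamma$, where $Y_i$ is included if all its parties occur in $\Gamma$). Completely monogamous. $D_{A_1:\cdots:A_n}$ is completely monogamous if it is complete and satisfies the dis-correlated condition: for all finite-dimensional systems, all states $\rho$ of $A_1\cdots A_n$ and all partitions with $X_1|\cdots|X_k\succ^{a,b}Y_1|\cdots|Y_l$ (of $A_1\cdots A_n$ or of a subsystem), $D_{X_1:\cdots:X_k}=D_{Y_1:\cdots:Y_l}$ implies $D_\Gamma=0$ for all $\Gamma\in\Xi(X_1|\cdots|X_k-Y_1|\cdots|Y_l)$, where $D_\Gamma$ is the GQD of the partition $\Gamma$. *)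

(* Defs.v *)
From HB Require Import structures.
From mathcomp Require Import all_boot all_order all_algebra.
From mathcomp Require Import complex.
From mathcomp Require Import boolp classical_sets reals exp.

Set Implicit Arguments.
Unset Strict Implicit.
Unset Printing Implicit Defensive.

Import Order.TTheory GRing.Theory Num.Theory.
Local Open Scope ring_scope.
Local Open Scope complex_scope.
Local Open Scope sesquilinear_scope.

(* A finite-dimensional Hilbert space is given by a finite type T labelling an
   orthonormal basis.  Its operators are matrices whose rows and columns are
   numbered through the enumeration of T; the scalars are R[i], R a realType. *)
Notation "''Op[' R ]_ T" := 'M[R[i]]_#|T|
  (at level 8, T at level 2, format "''Op[' R ]_ T").

Definition entry (R : realType) (T : finType) (M : 'Op[R]_T) (s t : T) : R[i] :=
  M (enum_rank s) (enum_rank t).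

Definition is_state (R : realType) (T : finType) (rho : 'Op[R]_T) : Prop :=
  [/\ rho \is hermsymmx,
      forall v : 'cV[R[i]]_#|T|, 0 <= (v ^t* *m rho *m v) 0 0
    & \tr rho = 1].

(* f(M) for a Hermitian matrix M and a real function f, by diagonalization. *)
Definition mxfun (R : realType) (n : nat) (f : R -> R) (M : 'M[R[i]]_n) :
    'M[R[i]]_n :=
  invmx (spectralmx M)
    *m diag_mx (map_mx (fun z => (f (complex.Re z))%:C) (spectral_diag M))
    *m spectralmx M.

(* ln 0 = 0 in the library, which yields the convention 0 log 0 = 0. *)
Definition logmx (R : realType) (b : R) (n : nat) (M : 'M[R[i]]_n) :
    'M[R[i]]_n :=
  mxfun (fun x => ln x / ln b) M.

(* The trace is a real number; Re only brings it back into R. *)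
Definition entropy (R : realType) (b : R) (n : nat) (rho : 'M[R[i]]_n) : R :=
  - complex.Re (\tr (rho *m logmx b rho)).

(* Basis of the tensor product of the spaces with bases B i, i : I. *)
Definition joint (I : finType) (B : I -> finType) : finType :=
  {dffun forall i : I, B i}.

(* Partial trace along a factorization of the basis T into a kept part, read off
   by keep, and an environment: env u v says that u and v have the same
   environment part. *)
Definition ptrace (R : realType) (T T' : finType) (keep : T -> T')
    (env : rel T) (rho : 'Op[R]_T) : 'Op[R]_T' :=
  \matrix_(a, c)
    \sum_(u : T) \sum_(v : T | [&& keep u == enum_val a, keep v == enum_val c
                                 & env u v])
      entry rho u v.

Section Discord.
Variables (R : realType) (b : R) (k : nat) (B : 'I_k -> finType).

Definition marginal (s : 'I_k) (rho : 'Op[R]_(joint B)) : 'Op[R]_(B s) :=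
  ptrace (fun u : joint B => u s)
    (fun u v : joint B => [forall t, (t != s) ==> (u t == v t)]) rho.

Definition mutual_info (rho : 'Op[R]_(joint B)) : R :=
  \sum_s entropy b (marginal s rho) - entropy b rho.

(* Completeness and rank one force as many outcomes as basis vectors, so the
   outcomes are indexed by T itself. *)
Definition is_vN_measurement (T : finType) (P : T -> 'Op[R]_T) : Prop :=
  [/\ forall j, P j \is hermsymmx,
      forall j l, P j *m P l = if j == l then P j else 0,
      forall j, \rank (P j) = 1%N
    & \sum_j P j = 1%:M].

Definition tensor (M : forall s, 'Op[R]_(B s)) : 'Op[R]_(joint B) :=
  \matrix_(a, c)
    \prod_s entry (M s) ((enum_val a : joint B) s) ((enum_val c : joint B) s).

Definition measure_local (P : forall s, B s -> 'Op[R]_(B s))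
    (rho : 'Op[R]_(joint B)) : 'Op[R]_(joint B) :=
  \sum_(j : joint B)
     let Pj := tensor (fun s => P s (j s)) in Pj *m rho *m Pj.

(* On a state the infimum is a minimum: the local measurements form a nonempty
   compact set (up to outcome labels) and the objective is continuous. *)
Definition gqd (rho : 'Op[R]_(joint B)) : R :=
  inf [set x : R | exists P : forall s, B s -> 'Op[R]_(B s),
         (forall s, is_vN_measurement (P s)) /\
         x = mutual_info rho - mutual_info (measure_local P rho)]%classic.

End Discord.

Section Partitions.
Variable n : nat.
Implicit Types (X Y G l : seq {set 'I_n}) (P Q : {set 'I_n}).

Definition is_partition X : bool :=
  [&& (2 <= size X)%N, all (fun P => P != finset.set0) X
    & pairwise (fun P Q => [forall i in P, forall j in Q, (i < j)%N]) X].

Definition parties X : {set 'I_n} := (\bigcup_(P <- X) P)%SET.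

(* At least one operation is applied, so this is not reflexive. *)
Inductive coarser_ab : seq {set 'I_n} -> seq {set 'I_n} -> Prop :=
| Discard l1 P l2 : coarser_ab (l1 ++ P :: l2) (l1 ++ l2)
| Combine l1 P Q l2 :
    coarser_ab (l1 ++ P :: Q :: l2) (l1 ++ (P :|: Q)%SET :: l2)
| Then X Y Z : coarser_ab X Y -> coarser_ab Y Z -> coarser_ab X Z.

(* The parties of the last block are discarded first; this loses no generality,
   as the block in question is the last one of the initial partition. *)
Definition coarser X Y : Prop :=
  coarser_ab X Y \/
  exists l P Q, [/\ X = rcons l P, Q != finset.set0, Q \proper P
                  & Y = rcons l Q \/ coarser_ab (rcons l Q) Y].

(* Either no block of Y is included in G, or some but not all of them are. *)
Definition in_Xi X Y G : Prop :=
  [/\ is_partition G, coarser X G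
    & let included P := P \subset parties G in
      ~~ has included Y \/ (has included Y /\ ~~ all included Y)].

End Partitions.

Section Monogamy.
Variables (R : realType) (b : R) (n : nat).

Definition block (B : 'I_n -> finType) (P : {set 'I_n}) : finType :=
  joint (fun i : {i : 'I_n | i \in P} => B (val i)).

Definition blocks (B : 'I_n -> finType) (X : seq {set 'I_n})
    (s : 'I_(size X)) : finType :=
  block B (nth finset.set0 X s).

Definition regroup (B : 'I_n -> finType) (X : seq {set 'I_n})
    (u : joint B) : joint (@blocks B X) :=
  [ffun s => [ffun i => u (val i)]].

(* The reduced state on the parties of X, each block of X being one particle. *)
Definition reduced (B : 'I_n -> finType) (X : seq {set 'I_n})
    (rho : 'Op[R]_(joint B)) : 'Op[R]_(joint (@blocks B X)) :=
  ptrace (@regroup B X)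
    (fun u v : joint B => [forall i, (i \notin parties X) ==> (u i == v i)])
    rho.

Definition gqd_of (B : 'I_n -> finType) (X : seq {set 'I_n})
    (rho : 'Op[R]_(joint B)) : R :=
  gqd b (reduced X rho).

Definition gqd_complete : Prop :=
  forall (B : 'I_n -> finType) (rho : 'Op[R]_(joint B)), is_state rho ->
  forall X Y : seq {set 'I_n}, is_partition X -> is_partition Y ->
    coarser_ab X Y -> gqd_of Y rho <= gqd_of X rho.

Definition gqd_discorrelated : Prop :=
  forall (B : 'I_n -> finType) (rho : 'Op[R]_(joint B)), is_state rho ->
  forall X Y : seq {set 'I_n}, is_partition X -> is_partition Y ->
    coarser_ab X Y -> gqd_of X rho = gqd_of Y rho ->
  forall G : seq {set 'I_n}, in_Xi X Y G -> gqd_of G rho = 0.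

Definition gqd_completely_monogamous : Prop :=
  gqd_complete /\ gqd_discorrelated.

End Monogamy.

(* Main.v *)
(* The dis-correlated condition fails.  Let A_1, A_2 share a Bell pair and let
   every other party be one-dimensional.  Then A_1|A_2|A_3, A_1|A_2A_3 and A_1|A_2
   have the same discord log 2, while A_1|A_2 includes A_1 but not A_2A_3 and so
   lies in Xi(A_1|A_2|A_3 - A_1|A_2A_3).

   The discord is log 2 because the marginals of the Bell state are maximally
   mixed, hence fixed by every local measurement Phi, and the state is pure, so
   that I(rho) - I(Phi(rho)) = S(Phi(rho)).  Each eigenvalue of Phi(rho) is the
   probability of a joint outcome, at most the probability 1/2 of the outcome of
   one qubit, so S(Phi(rho)) >= log 2; the computational basis attains equality. *)

Require Import Defs.
From mathcomp Require Import all_boot all_order all_algebra.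
From mathcomp Require Import reals.
From mathcomp Require Import complex boolp classical_sets exp.
From mathcomp Require Import ring.

Set Implicit Arguments.
Unset Strict Implicit.
Unset Printing Implicit Defensive.

Import Order.TTheory GRing.Theory Num.Theory.
Local Open Scope ring_scope.
Local Open Scope sesquilinear_scope.

(** * Entropy of a Hermitian matrix through its eigenvalues *)

Lemma complex_half (R : realType) : 2^-1 = ((2^-1 : R)%:C)%C.
Proof. by rewrite fmorphV rmorph_nat. Qed.

Section Spectrum.
Variables (R : realType) (b : R) (n : nat) (M : 'M[R[i]]_n).
Hypothesis hermM : M \is hermsymmx.

Let spectral_decomp : M =
  invmx (spectralmx M) *m diag_mx (spectral_diag M) *m spectralmx M.
Proof. exact/orthomx_spectralP/hermitian_normalmx. Qed.

Lemma spectral_row i :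
  row i (spectralmx M) *m M = spectral_diag M 0 i *: row i (spectralmx M).
Proof.
rewrite [X in _ *m X]spectral_decomp -row_mul !mulmxA mulmxV ?spectral_unit //.
by rewrite mul1mx row_mul row_diag_mx -scalemxAl -rowE.
Qed.

Lemma spectral_row_neq0 i : row i (spectralmx M) != 0.
Proof.
apply/eqP => row0; have := mulmxV (spectral_unit M).
move/row_matrixP/(_ i); rewrite row_mul row0 mul0mx row1 => /rowP/(_ i).
by rewrite !mxE !eqxx => /esym/eqP; rewrite oner_eq0.
Qed.

Lemma sum_spectral_diag : \sum_i spectral_diag M 0 i = \tr M.
Proof.
rewrite [in RHS]spectral_decomp mxtrace_mulC mulmxA mulmxV ?spectral_unit //.
by rewrite mul1mx mxtrace_diag.
Qed.

Lemma entropyE : entropy b M =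
  - \sum_i complex.Re (spectral_diag M 0 i) *
     (ln (complex.Re (spectral_diag M 0 i)) / ln b).
Proof.
rewrite /entropy /logmx /mxfun [X in X *m _]spectral_decomp.
rewrite -!mulmxA [_ *m (invmx _ *m _)]mulmxA mulmxV ?spectral_unit // mul1mx.
rewrite mxtrace_mulC -!mulmxA mulmxV ?spectral_unit // mulmx1 mulmx_diag.
rewrite mxtrace_diag (raddf_sum (@complex.Re R : Rcomplex R -> R)).
congr (- _); apply: eq_bigr => i _; rewrite !mxE.
(* The factor coming from [mxfun] is real, so the real part passes through the product. *)
by case: (spectral_diag M 0 i) => x y /=; rewrite mulr0 subr0.
Qed.

Hypothesis trM : \tr M = 1.

Lemma sum_Re_spectral_diag : \sum_i complex.Re (spectral_diag M 0 i) = 1.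
Proof.
rewrite -(raddf_sum (@complex.Re R : Rcomplex R -> R)) /=.
by rewrite sum_spectral_diag trM.
Qed.

Hypothesis hb : 1 < b.

(** The eigenvalues are weights of total 1, so the entropy is an average of -log x, and x <= 1/2
    makes each term at least log 2. *)
Lemma entropy_ge_log2 :
    (forall i, 0 <= spectral_diag M 0 i <= 2^-1) -> ln 2 / ln b <= entropy b M.
Proof.
move=> bnd; rewrite entropyE -[_ / _]mul1r -[X in X * _ <= _]sum_Re_spectral_diag.
rewrite mulr_suml -sumrN; apply: ler_sum => i _.
have /andP[] := bnd i; move: (spectral_diag M 0 i) => x.
rewrite !lecE complex_half /=.
(* Null eigenvalues are treated apart, since the comparison of logarithms is made between positive
   reals. *)
move=> /andP[_ x0] /andP[_ x2]; move: x0; rewrite le_eqVlt => /orP[/eqP<-|x0].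
  by rewrite !mul0r oppr0.
rewrite -mulrN ler_pM2l // -mulNr ler_pM2r ?invr_gt0 ?ln_gt0 //.
by rewrite -[ln 2]opprK lerN2 -lnV ?posrE // ler_ln ?posrE // invr_gt0.
Qed.

Lemma entropy_eq_log2 :
    (forall i, spectral_diag M 0 i = 0 \/ spectral_diag M 0 i = 2^-1) ->
  entropy b M = ln 2 / ln b.
Proof.
move=> val; rewrite entropyE -[RHS]mul1r -[X in _ = X * _]sum_Re_spectral_diag.
rewrite mulr_suml -sumrN; apply: eq_bigr => i _.
case: (val i) => ->; first by rewrite !mul0r oppr0.
rewrite complex_half /=.
by rewrite lnV ?posrE // mulNr mulrN opprK.
Qed.

(** An eigenvalue x of an idempotent satisfies x^2 = x, and x log x vanishes at both 0 and 1. *)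
Lemma entropy_pure : M *m M = M -> entropy b M = 0.
Proof.
move=> idM; rewrite entropyE big1 ?oppr0 // => i _.
have : spectral_diag M 0 i = 0 \/ spectral_diag M 0 i = 1.
  have := congr1 (mulmx (row i (spectralmx M))) idM.
  rewrite mulmxA !spectral_row -scalemxAl spectral_row scalerA => /eqP.
  rewrite -subr_eq0 -scalerBl scaler_eq0 (negPf (spectral_row_neq0 i)) orbF.
  rewrite -{3}[spectral_diag M 0 i]mulr1 -mulrBr mulf_eq0 subr_eq0.
  by case/orP => /eqP; [left | right].
by case=> ->; rewrite /= ?mul0r // ln1 mul0r mulr0.
Qed.

End Spectrum.

(** * Entries, traces and positivity of operators *)

Section Entries.
Variables (R : realType) (T : finType).
Implicit Types M N : 'Op[R]_T.

Lemma op_eqP M N : (forall s t, entry M s t = entry N s t) -> M = N.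
Proof.
move=> eqMN; apply/matrixP => i j.
by have := eqMN (enum_val i) (enum_val j); rewrite /entry !enum_valK.
Qed.

Lemma sum_ord_enum (V : nmodType) (F : 'I_#|T| -> V) : \sum_i F i = \sum_t F (enum_rank t).
Proof. by rewrite (reindex (@enum_rank T)) //; apply/onW_bij/enum_rank_bij. Qed.

Lemma entryM M N s t : entry (M *m N) s t = \sum_u entry M s u * entry N u t.
Proof. by rewrite /entry mxE sum_ord_enum. Qed.

Lemma entry1 s t : entry (1%:M : 'Op[R]_T) s t = (s == t)%:R.
Proof. by rewrite /entry mxE (inj_eq enum_rank_inj). Qed.

Lemma entry_sum (I : finType) (P : pred I) (F : I -> 'Op[R]_T) s t :
  entry (\sum_(i | P i) F i) s t = \sum_(i | P i) entry (F i) s t.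
Proof. by rewrite /entry summxE. Qed.

Lemma entryB M N s t : entry (M - N) s t = entry M s t - entry N s t.
Proof. by rewrite /entry !mxE. Qed.

Lemma entryZ a M s t : entry (a *: M) s t = a * entry M s t.
Proof. by rewrite /entry mxE. Qed.

Lemma trace_entry M : \tr M = \sum_t entry M t t.
Proof. by rewrite /mxtrace sum_ord_enum. Qed.

Lemma hermsymmx_entryP M :
  reflect (forall s t, entry M s t = (entry M t s)^*)%C (M \is hermsymmx).
Proof.
apply: (iffP (is_hermitianmxP _ _ _)); rewrite expr0 scale1r.
  by move=> hM s t; rewrite /entry {1}hM !mxE.
by move=> hM; apply: op_eqP => s t; rewrite hM /entry !mxE.
Qed.

(** By idempotence tr(MN) = tr(MNM), whose diagonal entries are the values of the form N at the
    columns of M. It serves for outcome projections and for differences of projections. *)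
Lemma trace_mul_ge0 M N :
  M \is hermsymmx -> M *m M = M -> is_state N -> 0 <= \tr (M *m N).
Proof.
move=> /is_hermitianmxP; rewrite expr0 scale1r => hM idM [_ posN _].
rewrite -idM -mulmxA mxtrace_mulC /mxtrace; apply: sumr_ge0 => i _.
suff -> : (M *m N *m M) i i = ((col i M)^t* *m N *m col i M) 0 0 by [].
rewrite tr_col map_row -hM -row_mul !mxE; apply: eq_bigr => j _.
by rewrite !mxE.
Qed.

Lemma trace_delta_mul M i j : \tr (delta_mx j i *m M) = M i j.
Proof.
rewrite -(mul_delta_mx (0 : 'I_1)) -mulmxA -rowE mxtrace_mulC.
by rewrite -colE trace_mx11 !mxE.
Qed.

(** Matrix units K read off the entries. This identifies a marginal from its traces against local
    operators. *)
Lemma trace_mul_inj M N : (forall K, \tr (K *m M) = \tr (K *m N)) -> M = N.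
Proof.
by move=> eqtr; apply/matrixP => i j; rewrite -!trace_delta_mul eqtr.
Qed.

End Entries.

(** * Tensor products of local operators and their duality with marginals *)

Lemma joint_neqP (I : finType) (B : I -> finType) (u v : joint B) :
  reflect (exists s, u s != v s) (u != v).
Proof.
apply: (iffP idP) => [|[s]]; last by apply: contraNneq => ->.
move=> neq_uv; apply/existsP; apply: contraNT neq_uv => /existsPn eq_uv.
by apply/eqP/ffunP => s; apply/eqP/negPn/eq_uv.
Qed.

Section Tensor.
Variables (R : realType) (k : nat) (B : 'I_k -> finType).
Implicit Types M N : forall s, 'Op[R]_(B s).

(** The distributive law is taken on [fprod] and carried over to [joint] by the bijection
    [dffun_of_fprod]. *)
Lemma prod_sum_joint (F : forall s, B s -> R[i]) :
  \prod_s \sum_(x : B s) F s x = \sum_(j : joint B) \prod_s F s (j s).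
Proof.
rewrite (reindex (@dffun_of_fprod _ B)) /=; last first.
  exact/onW_bij/dffun_of_fprod_bij.
(* [big_fprod] expects a family of finite functions. *)
pose G s : {ffun B s -> R[i]} := [ffun x => F s x].
transitivity (\sum_(t : fprod B) \prod_(s in 'I_k) G s (t s)); last first.
  by apply: eq_bigr => t _; apply: eq_bigr => s _; rewrite !ffunE.
rewrite (@big_fprod _ 0 1 *%R _ _ B G).
rewrite -(bigA_distr_big_dep (tagged_with B) (fun s x => untag 0 (G s) x)).
apply: eq_bigr => s _.
transitivity (\sum_(x : B s) G s x); first by apply: eq_bigr=> x; rewrite ffunE.
exact: (big_tag (fun s x => G s x)).
Qed.

Lemma entry_tensor M u v :
  entry (tensor M) u v = \prod_s entry (M s) (u s) (v s).
Proof. by rewrite /entry mxE !enum_rankK. Qed.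

Lemma eq_tensor M N : (forall s, M s = N s) -> tensor M = tensor N.
Proof.
move=> eqMN; apply: op_eqP => u v; rewrite !entry_tensor.
by apply: eq_bigr => s _; rewrite eqMN.
Qed.

Lemma tensorM M N : tensor M *m tensor N = tensor (fun s => M s *m N s).
Proof.
apply: op_eqP => u v; rewrite entryM entry_tensor.
under [RHS]eq_bigr do rewrite entryM.
rewrite prod_sum_joint; apply: eq_bigr => w _.
by rewrite !entry_tensor -big_split.
Qed.

Lemma tensor1 : tensor (fun s => 1%:M : 'Op[R]_(B s)) = 1%:M.
Proof.
apply: op_eqP => u v; rewrite entry_tensor entry1.
under eq_bigr do rewrite entry1.
have [->|neq_uv] := eqVneq u v; first by rewrite big1 // => s _; rewrite eqxx.
have [s /negPf us] := joint_neqP _ _ neq_uv.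
by rewrite (bigD1 s) //= us mul0r.
Qed.

Lemma tensor_eq0 M s : M s = 0 -> tensor M = 0.
Proof.
move=> Ms0; apply: op_eqP => u v; rewrite entry_tensor (bigD1 s) //= Ms0.
by rewrite /entry !mxE mul0r.
Qed.

Lemma hermsymmx_tensor M :
  (forall s, M s \is hermsymmx) -> tensor M \is hermsymmx.
Proof.
move=> hM; apply/hermsymmx_entryP => u v; rewrite !entry_tensor rmorph_prod.
by apply: eq_bigr => s _; apply/hermsymmx_entryP.
Qed.

Lemma sum_tensor (P : forall s, B s -> 'Op[R]_(B s)) :
  \sum_(j : joint B) tensor (fun s => P s (j s)) =
  tensor (fun s => \sum_x P s x).
Proof.
apply: op_eqP => u v; rewrite entry_sum entry_tensor.
under [RHS]eq_bigr do rewrite entry_sum.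
by rewrite prod_sum_joint; apply: eq_bigr => j _; rewrite entry_tensor.
Qed.

Lemma measure_tensor (P : forall s, B s -> 'Op[R]_(B s)) M :
  measure_local P (tensor M) =
  tensor (fun s => \sum_x P s x *m M s *m P s x).
Proof.
rewrite -(sum_tensor (fun s x => P s x *m M s *m P s x)).
by apply: eq_bigr => j _ /=; rewrite !tensorM.
Qed.

Definition tensor_at s (N : 'Op[R]_(B s)) : 'Op[R]_(joint B) :=
  tensor (dfwith (fun t => 1%:M) N).

(** Adjointness of partial trace and tensoring with identities: the identity factors force equal
    indices off [s], which is the environment condition of the partial trace. *)
Lemma trace_marginal s (N : 'Op[R]_(B s)) rho :
  \tr (N *m marginal s rho) = \tr (tensor_at N *m rho).
Proof.
rewrite !trace_entry; under eq_bigr do rewrite entryM.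
under [RHS]eq_bigr do rewrite entryM.
have entry_at (u v : joint B) : entry (tensor_at N) u v =
    entry N (u s) (v s) *+ [forall t, (t != s) ==> (v t == u t)].
  rewrite entry_tensor (bigD1 s) //= dfwith_in; case: forallP => [eq_vu|].
    rewrite big1 ?mulr1 // => t ts; rewrite dfwith_out 1?eq_sym // entry1.
    by have /implyP/(_ ts)/eqP-> := eq_vu t; rewrite eqxx.
  move=> /forallP/forallPn[t]; rewrite negb_imply => /andP[ts vu].
  rewrite (bigD1 t) //= dfwith_out 1?eq_sym // entry1 eq_sym (negPf vu).
  by rewrite mul0r mulr0.
under [RHS]eq_bigr do under eq_bigr do rewrite entry_at.
(* Joint indices are grouped by their component at [s], to match the sums over [B s] on the left. *)
rewrite [RHS]exchange_big /= (partition_big (fun v : joint B => v s) predT) //=.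
rewrite exchange_big /=; apply: eq_bigr => y _.
under [RHS]eq_bigr do rewrite (partition_big (fun u : joint B => u s) predT) //=.
rewrite [RHS]exchange_big /=; apply: eq_bigr => x _.
rewrite {2}/entry mxE mulr_sumr !enum_rankK; under [LHS]eq_bigr do rewrite mulr_sumr.
rewrite [RHS]big_mkcond /=; apply: eq_bigr => v _.
case: eqP => [<-|_]; last by rewrite big1 // => u; case: (v s == y).
rewrite big_mkcond [RHS]big_mkcond /=; apply: eq_bigr => u _.
case: eqP => [<-|_] //=; case: ifP => _; rewrite ?mul0rn ?mul0r //.
Qed.

End Tensor.

(** * Outcomes of local von Neumann measurements and the measured state *)

Lemma rank1_idempotent (F : fieldType) n (P : 'M[F]_n) :
    \rank P = 1%N -> P *m P = P ->
  exists u : 'cV_n, exists2 v : 'rV_n, P = u *m v & v *m u = 1%:M.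
Proof.
move=> + idP; have := mulmx_base P.
move: (col_base_full P) (row_base_free P); move: (col_base P) (row_base P).
move: (\rank P) => r u v fu fv Puv r1; subst r; exists u, v => //.
(* Full rank allows u and v to be cancelled from u v u v = u v; rank one makes v u a 1 by 1
   matrix. *)
apply: (row_full_inj fu); apply: (row_free_inj fv).
by rewrite mulmxA -mulmxA mulmx1 Puv.
Qed.

Section Measurement.
Variables (R : realType) (k : nat) (B : 'I_k -> finType).
Variable P : forall s, B s -> 'Op[R]_(B s).
Hypothesis vN : forall s, is_vN_measurement (@P s).

Let proj (j : joint B) : 'Op[R]_(joint B) := tensor (fun s => P (j s)).

Lemma hermsymmx_proj j : proj j \is hermsymmx.
Proof. by apply: hermsymmx_tensor => s; case: (vN s). Qed.

Lemma projM j l : proj j *m proj l = if j == l then proj j else 0.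
Proof.
rewrite tensorM; have [<-|neq_jl] := eqVneq j l.
  by apply: eq_tensor => s; have [_ -> _ _] := vN s; rewrite eqxx.
have [s /negPf js] := joint_neqP _ _ neq_jl.
by apply: (@tensor_eq0 _ _ _ _ s); have [_ -> _ _] := vN s; rewrite js.
Qed.

Lemma sum_proj : \sum_j proj j = 1%:M.
Proof.
rewrite sum_tensor -[RHS]tensor1.
by apply: eq_tensor => s; have [_ _ _ ->] := vN s.
Qed.

Lemma measure_factor s x : exists u : 'cV[R[i]]_#|B s|,
  exists2 v : 'rV_#|B s|, P x = u *m v & v *m u = 1%:M.
Proof.
have [_ PM rkP _] := vN s; apply: rank1_idempotent; first exact: rkP.
by rewrite PM eqxx.
Qed.

Lemma trace_measure s (x : B s) : \tr (P x) = 1.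
Proof.
have [u [v -> vu]] := measure_factor x.
by rewrite mxtrace_mulC vu mxtrace1.
Qed.

(** A tensor product of outer products is the outer product of the product vectors, so joint
    outcomes stay rank one. *)
Lemma proj_factor j : exists u : 'cV[R[i]]_#|joint B|,
  exists v : 'rV_#|joint B|, proj j = u *m v.
Proof.
have fac s : {uv : 'cV[R[i]]_#|B s| * 'rV_#|B s| | P (j s) = uv.1 *m uv.2}.
  apply: cid; have [u [v Puv _]] := measure_factor (j s).
  by exists (u, v).
exists (\col_a \prod_s (sval (fac s)).1 (enum_rank ((enum_val a : joint B) s)) 0).
exists (\row_a \prod_s (sval (fac s)).2 0 (enum_rank ((enum_val a : joint B) s))).
apply/matrixP => a c; rewrite !mxE big_ord1 !mxE -big_split /=.
apply: eq_bigr => s _; rewrite /entry; case: (fac s) => -[u v] /= ->.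
by rewrite mxE big_ord1.
Qed.

(** With [proj j] = u v the left side is u (v rho u) v, and the scalar v rho u is tr(u v rho). *)
Lemma proj_sandwich j rho :
  proj j *m rho *m proj j = \tr (proj j *m rho) *: proj j.
Proof.
have [u [v ->]] := proj_factor j.
rewrite -[u *m v *m rho]mulmxA mxtrace_mulC -!mulmxA [v *m (rho *m _)]mulmxA.
rewrite [v *m rho *m _]mulmxA [v *m rho *m u]mx11_scalar trace_mx11.
by rewrite mulmxA mul_mx_scalar -scalemxAl mulmxA.
Qed.

Lemma measure_localE rho :
  measure_local P rho = \sum_j \tr (proj j *m rho) *: proj j.
Proof. by apply: eq_bigr => j _; apply: proj_sandwich. Qed.

Lemma trace_measure_local rho : \tr (measure_local P rho) = \tr rho.
Proof.
rewrite raddf_sum /= -[rho in RHS]mul1mx -sum_proj mulmx_suml raddf_sum /=.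
by apply: eq_bigr => j _; rewrite mxtrace_mulC mulmxA projM eqxx.
Qed.

(** The projections sum to 1, so a left eigenvector has a nonzero component along some [proj j].
    Multiplying the eigenvalue equation by [proj j] on the right leaves only the probability of
    j. *)
Lemma spectral_diag_measure_local rho i :
    measure_local P rho \is hermsymmx ->
  exists j, spectral_diag (measure_local P rho) 0 i = \tr (proj j *m rho).
Proof.
move=> hM; have := spectral_row hM i; have := spectral_row_neq0 (measure_local P rho) i.
set v := row i _; set x := spectral_diag _ 0 i => v0 vM.
have [j vj] : exists j, v *m proj j != 0.
  apply/existsP; apply: contraNT v0 => /existsPn v0.
  rewrite -[v]mulmx1 -sum_proj mulmx_sumr big1 // => j _.
  by apply/eqP/negPn/v0.
exists j; apply/eqP; rewrite -subr_eq0.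
have : (x - \tr (proj j *m rho)) *: (v *m proj j) == 0.
  rewrite scalerBl scalemxAl -vM -mulmxA measure_localE mulmx_suml.
  rewrite (bigD1 j) //= big1 => [|l lj]; rewrite -scalemxAl projM.
    by rewrite eqxx addr0 -scalemxAr subrr.
  by rewrite (negPf lj) scaler0.
by rewrite scaler_eq0 (negPf vj) orbF.
Qed.

Variables (rho : 'Op[R]_(joint B)) (c : 'I_k -> R[i]).
Hypothesis st : is_state rho.
Hypothesis mix : forall s, marginal s rho = (c s)%:M.

Lemma prob_ge0 j : 0 <= \tr (proj j *m rho).
Proof.
apply: trace_mul_ge0 => //; first exact: hermsymmx_proj.
by rewrite projM eqxx.
Qed.

Lemma hermsymmx_measure_local : measure_local P rho \is hermsymmx.
Proof.
apply/hermsymmx_entryP => s t; rewrite measure_localE !entry_sum rmorph_sum.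
apply: eq_bigr => j _; rewrite !entryZ rmorphM /=.
have /hermsymmx_entryP-> := hermsymmx_proj j.
congr (_ * _); apply/esym/CrealP/ger0_real/prob_ge0.
Qed.

(** The outcome [j s] at party [s] alone corresponds to E, the local projection tensored with
    identities. E dominates [proj j], as their difference is again an orthogonal projection, and E
    has probability [c s] because a rank-one projection has trace 1. *)
Lemma prob_le j s : \tr (proj j *m rho) <= c s.
Proof.
have [hermP PM _ _] := vN s.
pose E := tensor_at (P (j s)).
have trE : \tr (E *m rho) = c s.
  by rewrite -trace_marginal mix mul_mx_scalar linearZ /= trace_measure mulr1.
have hE : E \is hermsymmx.
  apply: hermsymmx_tensor => t; case: dfwithP => // u _.
  exact: hermitian1mx_subproof.
have EE : E *m E = E.
  rewrite tensorM; apply: eq_tensor => t.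
  by case: dfwithP => [|u _]; rewrite ?mulmx1 // PM eqxx.
have Ej : E *m proj j = proj j.
  rewrite tensorM; apply: eq_tensor => t.
  by case: dfwithP => [|u _]; rewrite ?mul1mx // PM eqxx.
have jE : proj j *m E = proj j.
  rewrite tensorM; apply: eq_tensor => t.
  by case: dfwithP => [|u _]; rewrite ?mulmx1 // PM eqxx.
rewrite -trE -subr_ge0 -linearB /= -mulmxBl; apply: trace_mul_ge0 => //.
  apply/hermsymmx_entryP => u v; rewrite !entryB rmorphB /=.
  have /hermsymmx_entryP-> := hE.
  by have /hermsymmx_entryP-> := hermsymmx_proj j.
by rewrite mulmxBl !mulmxBr EE Ej jE projM eqxx subrr subr0.
Qed.

(** A scalar marginal sees only the trace of a local operator N. The measurement is self-adjoint for
    the trace pairing and acts on N by the trace-preserving map sending N to the sum of the P x N P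
    x. *)
Lemma marginal_measure_local s : marginal s (measure_local P rho) = (c s)%:M.
Proof.
have [_ PM _ sumP] := vN s.
apply: trace_mul_inj => N; rewrite trace_marginal.
have -> : \tr (tensor_at N *m measure_local P rho) =
    \tr (measure_local P (tensor_at N) *m rho).
  rewrite mulmx_sumr mulmx_suml !raddf_sum /=; apply: eq_bigr => j _.
  by rewrite !mulmxA mxtrace_mulC !mulmxA.
have -> : measure_local P (tensor_at N) = tensor_at (\sum_x P x *m N *m P x).
  rewrite measure_tensor; apply: eq_tensor => t; case: dfwithP => [|u su].
    by rewrite dfwith_in.
  (* On the other factors the identity survives: the projections are idempotent and sum to 1. *)
  rewrite dfwith_out //; have [_ PuM _ sumPu] := vN u.
  rewrite -[RHS]sumPu; apply: eq_bigr => x _.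
  by rewrite mulmx1 PuM eqxx.
rewrite -trace_marginal mix !mul_mx_scalar !linearZ /=; congr (_ * _).
rewrite raddf_sum /= -[N in RHS]mul1mx -sumP mulmx_suml raddf_sum /=.
by apply: eq_bigr => x _; rewrite mxtrace_mulC mulmxA PM eqxx.
Qed.

End Measurement.

(** * Measurement in the computational basis *)

Section BasisMeasurement.
Variables (R : realType) (k : nat) (B : 'I_k -> finType).

Definition basis_measurement s (x : B s) : 'Op[R]_(B s) :=
  delta_mx (enum_rank x) (enum_rank x).

Lemma vN_basis_measurement s : is_vN_measurement (@basis_measurement s).
Proof.
split=> [x|x y|x|].
- apply/is_hermitianmxP; rewrite expr0 scale1r.
  by rewrite trmx_delta map_delta_mx.
- rewrite mul_delta_mx_cond (inj_eq enum_rank_inj).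
  by case: eqP => [->|].
- exact: mxrank_delta.
- by rewrite mx1_sum_delta sum_ord_enum.
Qed.

(** A tensor product of diagonal matrix units is again a diagonal matrix unit, which picks one
    diagonal entry. *)
Lemma trace_basis_measurement (j : joint B) rho :
  \tr (tensor (fun s => basis_measurement (j s)) *m rho) = entry rho j j.
Proof.
have -> : tensor (fun s => basis_measurement (j s)) =
    delta_mx (enum_rank j) (enum_rank j).
  apply: op_eqP => u v; rewrite entry_tensor /entry mxE.
  under eq_bigr do rewrite mxE !(inj_eq enum_rank_inj).
  rewrite !(inj_eq enum_rank_inj).
  case: (boolP (_ && _)) => [/andP[/eqP-> /eqP->]|].
    by rewrite big1 // => s _; rewrite !eqxx.
  rewrite negb_and => /orP[]/joint_neqP[s /negPf neq_s]; rewrite (bigD1 s) //=.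
    by rewrite neq_s mul0r.
  by rewrite neq_s andbF mul0r.
exact: trace_delta_mul.
Qed.

End BasisMeasurement.

(** * Discord of pure states with maximally mixed marginals *)

Section PureState.
Variables (R : realType) (b : R) (k : nat) (B : 'I_k -> finType).
Variables (rho : 'Op[R]_(joint B)) (c : 'I_k -> R[i]).
Hypotheses (hb : 1 < b) (st : is_state rho) (pure : rho *m rho = rho).
Hypothesis mix : forall s, marginal s rho = (c s)%:M.

Lemma discord_measure_local P : (forall s, is_vN_measurement (P s)) ->
  mutual_info b rho - mutual_info b (measure_local P rho) =
  entropy b (measure_local P rho).
Proof.
move=> vN; rewrite /mutual_info.
under [X in _ - (X - _)]eq_bigr do rewrite (marginal_measure_local vN mix) -mix.
have [hrho _ trrho] := st.
by rewrite (entropy_pure _ hrho pure) subr0 opprB addrC subrK.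
Qed.

(** Party [s0] bounds all outcome probabilities by 1/2, whatever the measurement; the condition on
    the diagonal makes the computational basis reach the resulting entropy bound. *)
Lemma gqd_eq_log2 s0 : c s0 = 2^-1 ->
  (forall u, entry rho u u = 0 \/ entry rho u u = 2^-1) ->
  gqd b rho = ln 2 / ln b.
Proof.
move=> cs0 diag_rho; have [_ _ trrho] := st.
have trM P : (forall s, is_vN_measurement (P s)) ->
  \tr (measure_local P rho) = 1 by move=> vN; rewrite trace_measure_local.
rewrite /gqd; set S := (X in inf X).
have lb : lbound S (ln 2 / ln b).
  move=> _ [P [vN ->]]; rewrite discord_measure_local //.
  have hM := hermsymmx_measure_local vN st.
  apply: entropy_ge_log2 => // [|i]; first exact: trM.
  have [j ->] := spectral_diag_measure_local vN i hM.
  by rewrite -cs0 (prob_ge0 vN) // (prob_le vN).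
have mem : S (ln 2 / ln b).
  have vN s := @vN_basis_measurement R _ B s.
  exists (@basis_measurement R _ B); split=> //.
  rewrite discord_measure_local //.
  have hM := hermsymmx_measure_local vN st.
  rewrite entropy_eq_log2 // => [|i]; first exact: trM.
  have [j ->] := spectral_diag_measure_local vN i hM.
  by rewrite trace_basis_measurement.
(* A lower bound that belongs to the set is its infimum. *)
apply/eqP; rewrite eq_le; apply/andP; split.
  by apply: ge_inf => //; exists (ln 2 / ln b).
by apply: lb_le_inf => //; exists (ln 2 / ln b).
Qed.

End PureState.

(** * Bell states and their reductions *)

Lemma hermitian_idempotent_state (R : realType) (T : finType) (M : 'Op[R]_T) :
  M \is hermsymmx -> M *m M = M -> \tr M = 1 -> is_state M.
Proof.
move=> hM idM trM; split=> // v.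
have /is_hermitianmxP := hM; rewrite expr0 scale1r => adjM.
(* The form at v is the squared norm of M v. *)
have -> : v^t* *m M *m v = (M *m v)^t* *m (M *m v).
  by rewrite trmx_mul map_mxM /= mulmxA -[_ *m M^t* *m M]mulmxA -adjM idM.
rewrite mxE; apply: sumr_ge0 => i _; rewrite !mxE mulrC.
exact: mul_conjC_ge0.
Qed.

Section Bell.
Variable R : realType.

(** Unnormalized amplitudes of |u0> + |u1>. For u0 = u1 the value at that label is 2, a case that
    occurs on blocks without a qubit. *)
Definition bell_coef (T : finType) (u0 u1 u : T) : R[i] :=
  ((u == u0) + (u == u1))%:R.

(** The basis is arbitrary so that the same formula applies after the parties are grouped into
    blocks. *)
Definition bell (T : finType) (u0 u1 : T) : 'Op[R]_T :=
  \matrix_(a, c) (2^-1 * bell_coef u0 u1 (enum_val a)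
                       * bell_coef u0 u1 (enum_val c)).

Section BellTheory.
Variables (T : finType) (u0 u1 : T).

Lemma entry_bell s t :
  entry (bell u0 u1) s t = 2^-1 * bell_coef u0 u1 s * bell_coef u0 u1 t.
Proof. by rewrite /entry mxE !enum_rankK. Qed.

Lemma sum_bell_coef (F : T -> R[i]) :
  \sum_u bell_coef u0 u1 u * F u = F u0 + F u1.
Proof.
have sum1 a : \sum_u (u == a)%:R * F u = F a.
  rewrite (bigD1 a) //= eqxx mul1r big1 ?addr0 // => u /negPf->.
  by rewrite mul0r.
rewrite /bell_coef; under eq_bigr do rewrite natrD mulrDl.
by rewrite big_split /= !sum1.
Qed.

(** Only the four terms |u><v| with u, v among [u0], [u1] occur, each of weight 1/2; [G] tells which
    of them reach the entry (x, y). *)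
Lemma bell_ptraceE (T' : finType) (keep : T -> T') (env : rel T) x y
    (G := fun u v => [&& keep u == x, keep v == y & env u v]%:R : R[i]) :
  entry (ptrace keep env (bell u0 u1)) x y =
  2^-1 * (G u0 u0 + G u0 u1 + (G u1 u0 + G u1 u1)).
Proof.
have sumG u : G u u0 + G u u1 = \sum_v bell_coef u0 u1 v * G u v.
  by rewrite sum_bell_coef.
rewrite !sumG -(sum_bell_coef (fun u => \sum_v bell_coef u0 u1 v * G u v)).
rewrite {1}/entry mxE !enum_rankK mulr_sumr; apply: eq_bigr => u _.
rewrite mulrA mulr_sumr big_mkcond; apply: eq_bigr => v _.
rewrite entry_bell /G; case: ifP => _.
  by rewrite mulr1.
by rewrite !mulr0.
Qed.

Hypothesis neq_u : u0 != u1.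

Lemma bell_coef_sqr u : bell_coef u0 u1 u * bell_coef u0 u1 u = bell_coef u0 u1 u.
Proof.
rewrite /bell_coef; have [->|_] := eqVneq u u0.
  by rewrite (negPf neq_u) mulr1.
by case: eqP => _; rewrite ?mulr1 ?mulr0.
Qed.

Lemma bell_diag u : entry (bell u0 u1) u u = 0 \/ entry (bell u0 u1) u u = 2^-1.
Proof.
rewrite entry_bell -mulrA bell_coef_sqr /bell_coef.
have [->|_] := eqVneq u u0; first by rewrite (negPf neq_u) mulr1; right.
by case: eqP => _; rewrite ?mulr1 ?mulr0; [right | left].
Qed.

Lemma hermsymmx_bell : bell u0 u1 \is hermsymmx.
Proof.
apply/hermsymmx_entryP => s t; rewrite !entry_bell !rmorphM fmorphV.
by rewrite !rmorph_nat mulrAC.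
Qed.

Lemma bell_coef_left : bell_coef u0 u1 u0 = 1.
Proof. by rewrite /bell_coef eqxx (negPf neq_u). Qed.

Lemma bell_coef_right : bell_coef u0 u1 u1 = 1.
Proof. by rewrite /bell_coef eqxx eq_sym (negPf neq_u). Qed.

Lemma bell_pure : bell u0 u1 *m bell u0 u1 = bell u0 u1.
Proof.
apply: op_eqP => s t; rewrite entryM entry_bell.
transitivity (\sum_u bell_coef u0 u1 u * (2^-1 * bell_coef u0 u1 s *
    (2^-1 * bell_coef u0 u1 t) * bell_coef u0 u1 u)).
  by apply: eq_bigr => u _; rewrite !entry_bell; ring.
by rewrite sum_bell_coef bell_coef_left bell_coef_right; field.
Qed.

Lemma trace_bell : \tr (bell u0 u1) = 1.
Proof.
rewrite trace_entry; under eq_bigr do rewrite entry_bell mulrC.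
by rewrite sum_bell_coef bell_coef_left bell_coef_right; field.
Qed.

Lemma bell_state : is_state (bell u0 u1).
Proof.
exact: hermitian_idempotent_state hermsymmx_bell bell_pure trace_bell.
Qed.

End BellTheory.

(** When the discarded parts of [u0] and [u1] agree, all four terms survive and no coherence is
    lost. *)
Lemma ptrace_bell (T T' : finType) (keep : T -> T') (env : rel T) u0 u1 :
    {in pred2 u0 u1 &, forall u v, env u v} ->
  ptrace keep env (bell u0 u1) = bell (keep u0) (keep u1).
Proof.
move=> envT; apply: op_eqP => x y; rewrite bell_ptraceE entry_bell.
rewrite !envT ?inE ?eqxx ?orbT // !andbT /bell_coef -mulrA; congr (_ * _).
rewrite ![x == _]eq_sym ![y == _]eq_sym.
by rewrite -!mulnb !natrM !natrD; ring.
Qed.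

Section BellDiscord.
Variables (b : R) (k : nat) (B : 'I_k -> finType) (u0 u1 : joint B).
Hypothesis hb : 1 < b.
Hypothesis separated : forall s, exists2 t, t != s & u0 t != u1 t.

(** By [separated], some discarded party distinguishes [u0] from [u1], so the cross terms vanish and
    a diagonal matrix remains. The constant is 1/2 on a qubit and 1 on a one-dimensional factor. *)
Lemma marginal_bell s (c : R[i]) :
    (forall x, 2^-1 * bell_coef (u0 s) (u1 s) x = c) ->
  marginal s (bell u0 u1) = c%:M.
Proof.
move=> mix; apply: op_eqP => x y; rewrite bell_ptraceE.
have envF : [forall t, (t != s) ==> (u0 t == u1 t)] = false.
  have [t ts /negPf ut] := separated s.
  by apply/negP => /forallP/(_ t); rewrite ts ut.
have envF' : [forall t, (t != s) ==> (u1 t == u0 t)] = false.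
  by rewrite -envF; apply: eq_forallb => t; rewrite [u1 t == _]eq_sym.
have envT (u : joint B) : [forall t, (t != s) ==> (u t == u t)].
  by apply/forallP => t; rewrite eqxx implybT.
rewrite envF envF' !envT !andbF !andbT addr0 add0r.
rewrite -scalemx1 entryZ entry1 -(mix x) /bell_coef natrD -mulrA.
congr (_ * _); rewrite mulrDl -!natrM !mulnb ![x == u0 s]eq_sym ![x == u1 s]eq_sym.
by do 2?congr (_ + _); case: eqP => //= ->.
Qed.

Lemma gqd_bell s0 :
    (forall s, exists c, forall x, 2^-1 * bell_coef (u0 s) (u1 s) x = c) ->
    (forall x, 2^-1 * bell_coef (u0 s0) (u1 s0) x = 2^-1) ->
  gqd b (bell u0 u1) = ln 2 / ln b.
Proof.
move=> mix half; have [t _ neq_t] := separated s0.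
have neq_u : u0 != u1 by apply: contraNneq neq_t => ->.
(* [mix] provides some scalar for each [s]; at [s0] the value 1/2 is imposed, as [gqd_eq_log2] asks
   for it. *)
pose c s := if s == s0 then 2^-1 else sval (cid (mix s)).
apply: (@gqd_eq_log2 _ _ _ _ _ c _ _ _ _ s0) => //.
- exact: bell_state.
- exact: bell_pure.
- move=> s; apply: marginal_bell; rewrite /c; case: eqP => [->//|_].
  by case: cid.
- by rewrite /c eqxx.
- exact: bell_diag.
Qed.

End BellDiscord.
End Bell.

(** * A Bell pair shared by two of n parties *)

Section BellPair.
Variables (R : realType) (b : R) (n : nat) (i0 i1 : 'I_n).
Hypothesis hb : 1 < b.

(* Parties [i0] and [i1] hold qubits, all other parties are one-dimensional. *)
Definition pair_basis (i : 'I_n) : finType := 'I_(i \in pred2 i0 i1).+1.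

Definition ground : joint pair_basis := [ffun i => ord0].
(** [ord_max] is 1 on a qubit and 0 on a one-dimensional party, so [excited] differs from [ground]
    exactly at [i0] and [i1]. *)
Definition excited : joint pair_basis := [ffun i => ord_max].

Lemma pair_basis_trivial i (x y : pair_basis i) : i \notin pred2 i0 i1 -> x = y.
Proof.
by move: x y; rewrite /pair_basis => + + /negPf ni; rewrite ni => x y; rewrite !ord1.
Qed.

Lemma ground_neq_excited i : i \in pred2 i0 i1 -> ground i != excited i.
Proof. by move=> hi; rewrite !ffunE -val_eqE /= hi. Qed.

Lemma qubit_cases i (x : pair_basis i) : x = ground i \/ x = excited i.
Proof.
have := ltn_ord x; rewrite !ffunE => ltx.
have [x0|x0] := posnP (val x); first by left; apply: val_inj.
right; apply/val_inj/eqP; rewrite eqn_leq /= -ltnS ltx.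
exact: leq_trans (leq_b1 _) x0.
Qed.

Section Blocks.
Variable X : seq {set 'I_n}.

Let w0 := regroup X ground.
Let w1 := regroup X excited.

Lemma regroup_inj (s : 'I_(size X)) i : i \in nth finset.set0 X s -> i \in pred2 i0 i1 ->
  w0 s != w1 s.
Proof.
move=> iX hi; apply/joint_neqP; exists (exist _ i iX).
by rewrite !ffunE; have := ground_neq_excited hi; rewrite !ffunE.
Qed.

(** The only qubit of the block determines a basis label of the block, which is therefore one of the
    distinct labels [w0 s] and [w1 s]. *)
Lemma bell_coef_qubit (s : 'I_(size X)) i : i \in nth finset.set0 X s -> i \in pred2 i0 i1 ->
    {in nth finset.set0 X s, forall j, j \in pred2 i0 i1 -> j = i} ->
  forall x, bell_coef R (w0 s) (w1 s) x = 1.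
Proof.
move=> iX hi uniq_i x; have w01 := regroup_inj iX hi.
have agree (u : joint pair_basis) : x (exist _ i iX) = u i -> x = regroup X u s.
  move=> xu; apply/ffunP => -[j jX]; rewrite !ffunE /=.
  have /orP[hj|hj] := orbN (j \in pred2 i0 i1); last exact: pair_basis_trivial.
  have eq_ji := uniq_i j jX hj; subst j.
  (* Coordinates of x are indexed by a party with a proof of membership, so the two proofs have to
     be identified. *)
  by rewrite -xu (bool_irrelevance jX iX).
have [/agree->|/agree->] := qubit_cases (x (exist _ i iX)).
  exact: bell_coef_left.
exact: bell_coef_right.
Qed.

(** Such a block is one-dimensional, so both labels equal x and each contributes 1. *)
Lemma bell_coef_trivial (s : 'I_(size X)) :
    {in nth finset.set0 X s, forall j, j \notin pred2 i0 i1} ->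
  forall x, bell_coef R (w0 s) (w1 s) x = 2.
Proof.
move=> triv x.
have agree u : x = regroup X u s.
  by apply/ffunP => -[j jX]; apply: pair_basis_trivial; apply: triv.
by rewrite /bell_coef -!agree eqxx.
Qed.

(** Only one-dimensional parties are traced out, so the reduced state is again a Bell state, shared
    by the blocks [s0] and [s1]. This treats at once all partitions that separate the two qubits. *)
Lemma gqd_of_bell (s0 s1 : 'I_(size X)) :
    i0 \in nth finset.set0 X s0 -> i1 \in nth finset.set0 X s1 ->
    (forall s : 'I_(size X),
       ~~ ((i0 \in nth finset.set0 X s) && (i1 \in nth finset.set0 X s))) ->
  gqd_of b X (bell R ground excited) = ln 2 / ln b.
Proof.
move=> i0X i1X sep.
have in0 : i0 \in pred2 i0 i1 by rewrite !inE eqxx.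
have in1 : i1 \in pred2 i0 i1 by rewrite !inE eqxx orbT.
have s01 : s0 != s1.
  by apply: contraTneq i1X => <-; have := sep s0; rewrite i0X.
have only0 (s : 'I_(size X)) : i0 \in nth finset.set0 X s ->
    {in nth finset.set0 X s, forall j, j \in pred2 i0 i1 -> j = i0}.
  move=> i0s j js; rewrite !inE => /orP[/eqP//|/eqP ji].
  by have := sep s; rewrite i0s -ji js.
have only1 (s : 'I_(size X)) : i1 \in nth finset.set0 X s ->
    {in nth finset.set0 X s, forall j, j \in pred2 i0 i1 -> j = i1}.
  move=> i1s j js; rewrite !inE => /orP[/eqP ji|/eqP//].
  by have := sep s; rewrite i1s -ji js.
rewrite /gqd_of /reduced ptrace_bell => [|u v].
  apply: (gqd_bell hb _ (s0 := s0)) => [s|s|x].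
  (* Outside any given block there remains one of the two qubit blocks, where the labels differ. *)
  - have [->|ns0] := eqVneq s s0.
      by exists s1; [rewrite eq_sym | apply: regroup_inj i1X in1].
    by exists s0; [rewrite eq_sym | apply: regroup_inj i0X in0].
  - have [i0s|ni0s] := boolP (i0 \in nth finset.set0 X s).
      exists 2^-1 => x.
      by rewrite (bell_coef_qubit i0s in0 (only0 s i0s)) mulr1.
    have [i1s|ni1s] := boolP (i1 \in nth finset.set0 X s).
      exists 2^-1 => x.
      by rewrite (bell_coef_qubit i1s in1 (only1 s i1s)) mulr1.
    (* A block without a qubit has the scalar marginal 2^-1 * 2 = 1. *)
    exists 1 => x; rewrite bell_coef_trivial ?mulVf ?pnatr_eq0 // => j js.
    rewrite !inE; apply/norP.
    by split; [apply: contraNneq ni0s | apply: contraNneq ni1s] => <-.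
  - by rewrite (bell_coef_qubit i0X in0 (only0 s0 i0X)) mulr1.
(* A party outside [X] is neither [i0] nor [i1], hence one-dimensional, and all labels agree on
   it. *)
move=> _ _; apply/forallP => i; apply/implyP => iX.
apply/eqP; apply: pair_basis_trivial; apply: contra iX.
have sub s : (s < size X)%N -> nth finset.set0 X s \subset parties X.
  move=> ltsX; rewrite /parties (big_nth finset.set0) big_mkord.
  exact: (finset.bigcup_sup (Ordinal ltsX)).
rewrite !inE => /orP[]/eqP->.
  exact: (fintype.subsetP (sub s0 (ltn_ord s0)) _ i0X).
exact: (fintype.subsetP (sub s1 (ltn_ord s1)) _ i1X).
Qed.

End Blocks.
End BellPair.

(** * Three partitions violating the dis-correlated condition *)

Theorem theorem10 (R : realType) (b : R) (n : nat) (hb : 1 < b)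
    (hn : (3 <= n)%N) :
  ~ gqd_completely_monogamous b n.
Proof.
case: n hn => [|[|[|m]]] // _ [_ discorr].
pose i0 : 'I_m.+3 := ord0.
pose i1 : 'I_m.+3 := Ordinal (isT : (1 < m.+3)%N).
pose i2 : 'I_m.+3 := Ordinal (isT : (2 < m.+3)%N).
(* For n > 3 the parties after the third occur in none of these partitions and are traced out. *)
pose X := [:: [set i0]; [set i1]; [set i2]]%SET.
pose Y := [:: [set i0]; [set i1] :|: [set i2]]%SET.
pose G := [:: [set i0]; [set i1]]%SET.
pose rho := bell R (ground i0 i1) (excited i0 i1).
have gX : gqd_of b X rho = ln 2 / ln b.
  apply: (gqd_of_bell hb (s0 := @Ordinal (size X) 0 isT)
    (s1 := @Ordinal (size X) 1 isT)); rewrite ?inE //.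
  by case=> [[|[|[|]]]] //= _; rewrite !inE.
have gY : gqd_of b Y rho = ln 2 / ln b.
  apply: (gqd_of_bell hb (s0 := @Ordinal (size Y) 0 isT)
    (s1 := @Ordinal (size Y) 1 isT)); rewrite ?inE //.
  by case=> [[|[|]]] //= _; rewrite !inE.
have gG : gqd_of b G rho = ln 2 / ln b.
  apply: (gqd_of_bell hb (s0 := @Ordinal (size G) 0 isT)
    (s1 := @Ordinal (size G) 1 isT)); rewrite ?inE //.
  by case=> [[|[|]]] //= _; rewrite !inE.
have st : is_state rho.
  apply: bell_state; apply/joint_neqP; exists i0.
  by apply: ground_neq_excited; rewrite !inE eqxx.
have set1_neq0 (i : 'I_m.+3) : [set i]%SET != finset.set0.
  by apply/set0Pn; exists i; rewrite inE.
have set1_lt (i j : 'I_m.+3) : (i < j)%N ->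
    [forall k in [set i]%SET, forall l in [set j]%SET, (k < l)%N].
  move=> ij; apply/forall_inP => k /set1P->.
  by apply/forall_inP => l /set1P->.
have pX : is_partition X by rewrite /is_partition /= !set1_neq0 !set1_lt.
have pG : is_partition G by rewrite /is_partition /= !set1_neq0 !set1_lt.
have pY : is_partition Y.
  rewrite /is_partition /= set1_neq0 !andbT; apply/andP; split.
    by apply/set0Pn; exists i1; rewrite !inE eqxx.
  apply/forall_inP => k /set1P->; apply/forall_inP => l.
  by rewrite !inE => /orP[]/eqP->.
have XY : coarser_ab X Y by apply: (Combine [:: [set i0]%SET] _ _ [::]).
have XG : coarser X G.
  by left; apply: (Discard [:: [set i0]; [set i1]]%SET _ [::]).
have eqXY : gqd_of b X rho = gqd_of b Y rho by rewrite gX gY.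
have partG : parties G = [set i0; i1]%SET.
  by rewrite /parties !big_cons big_nil finset.setU0.
have inXi : in_Xi X Y G.
  (* The first block of [Y] is covered by [G]; the second is not, as it contains [i2]. *)
  split=> //; right; rewrite /= partG !finset.sub1set !inE eqxx /=; split=> //.
  rewrite andbT; apply/fintype.subsetPn; exists i2; first by rewrite !inE eqxx orbT.
  by rewrite !inE.
have := discorr _ _ st _ _ pX pY XY eqXY _ inXi.
(* Since the inverse of 0 is 0, a vanishing quotient means ln 2 = 0 or ln b = 0; both logarithms are
   positive. *)
move/eqP; rewrite gG mulf_eq0 invr_eq0 => /orP[]/eqP ln0.
  by have := ln_gt0 (ltr1n R 2); rewrite ln0 ltxx.
by have := ln_gt0 hb; rewrite ln0 ltxx.
Qed.
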